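(* Let $n$ be an integer with $3\le n<\infty$, and let $A=\mathrm{IDD}(K^1_n,2,0)$ be the complex algebra with basis $e_1,\ldots,e_n$ and bilinear multiplication $e_i\diamond e_j=i(i-1)e_{i+j-2}$ if $3\le i+j\le n+2$, and $e_i\diamond e_j=0$ otherwise. Then the space of derivations of $A$ is $$\mathfrak{Der}(A)=\langle\varphi\rangle,\qquad \varphi(e_i)=(i-2)e_i\quad(1\le i\le n).$$
   Context: A derivation of an algebra $(A,\diamond)$ is a linear map $D:A\to A$ with $D(a\diamond b)=D(a)\diamond b+a\diamond D(b)$ for all $a,b\in A$. $\langle S\rangle$ denotes the linear span of $S$ over $\mathbb C$. *)

(* Defs.v *)
From HB Require Import structures.
From mathcomp Require Import all_boot all_order all_algebra.
From mathcomp Require Import boolp classical_sets reals complex.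

Set Implicit Arguments.
Unset Strict Implicit.
Unset Printing Implicit Defensive.

Import GRing.Theory.
Local Open Scope ring_scope.
Local Open Scope classical_set_scope.

(* An algebra is a vector space with a multiplication, which need be neither
   associative nor unital; hence no MathComp algebra structure is used. *)
Definition Der (F : fieldType) (A : vectType F) (mul : A -> A -> A) :
    set 'End(A) :=
  [set D | forall a b : A, D (mul a b) = mul (D a) b + mul a (D b)].

Section IDD.
Variables (F : fieldType) (n : nat).

Definition IDD : vectType F := 'rV[F]_n.

(* Basis vectors carry the indices 1, ..., n, shifted by one with respect to
   'I_n; outside this range [idd_e k] is 0. *)
Definition idd_e (k : nat) : IDD := \row_(j < n) (j.+1 == k)%:R.

Definition idd_table (i j : nat) : IDD :=
  if (3 <= i + j <= n + 2)%N
  then (i * (i - 1))%:R *: idd_e (i + j - 2)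
  else 0.

Definition idd_mul (x y : IDD) : IDD :=
  \sum_(i < n) \sum_(j < n)
    ((x : 'rV[F]_n) 0 i * (y : 'rV[F]_n) 0 j) *: idd_table i.+1 j.+1.

Definition idd_phi : 'End(IDD) :=
  linfun (mulmxr (\matrix_(i < n) ((i.+1%:R - 2) *: idd_e i.+1 : 'rV[F]_n))
          : 'rV[F]_n -> 'rV[F]_n).

Lemma idd_eE (i : 'I_n) : idd_e i.+1 = delta_mx 0 i.
Proof. by apply/rowP => j; rewrite !mxE eqSS eqxx. Qed.

Lemma idd_e_basis : basis_of fullv [seq idd_e i.+1 | i : 'I_n].
Proof.
rewrite basisEdim size_map size_enum_ord dimvf /dim /= mul1n leqnn andbT.
apply/subvP => x _; rewrite (row_sum_delta (x : 'rV[F]_n)).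
apply: rpred_sum => i _; apply: rpredZ; apply: memv_span.
by apply/mapP; exists i; rewrite ?mem_enum ?idd_eE.
Qed.

Lemma idd_mul_linearl (y : IDD) : linear (idd_mul^~ y).
Proof.
move=> a u v; rewrite /idd_mul scaler_sumr -big_split; apply: eq_bigr => i _.
rewrite scaler_sumr -big_split; apply: eq_bigr => j _ /=.
by rewrite !mxE mulrDl scalerDl -mulrA scalerA.
Qed.

Lemma idd_mul_linearr (x : IDD) : linear (idd_mul x).
Proof.
move=> a u v; rewrite /idd_mul scaler_sumr -big_split; apply: eq_bigr => i _.
rewrite scaler_sumr -big_split; apply: eq_bigr => j _ /=.
by rewrite !mxE mulrDr scalerDl mulrCA scalerA.
Qed.

Lemma idd_mulE (i j : nat) : (1 <= i <= n)%N -> (1 <= j <= n)%N ->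
  idd_mul (idd_e i) (idd_e j) =
  if (3 <= i + j <= n + 2)%N then (i * (i - 1))%:R *: idd_e (i + j - 2) else 0.
Proof.
case: i j => [//|i] [//|j] /andP[_ ltin] /andP[_ ltjn].
pose i0 := Ordinal ltin; pose j0 := Ordinal ltjn.
rewrite /idd_mul (bigD1 i0) //= (bigD1 j0) //= !mxE !eqxx mulr1 scale1r.
rewrite [X in _ + X + _]big1 ?[X in _ + X]big1 ?addr0 //.
  move=> k nk; rewrite big1 // => l _; rewrite mxE eqSS.
  by rewrite (_ : (k == i :> nat) = false) ?mul0r ?scale0r //; apply/negbTE.
move=> l nl; rewrite !mxE eqSS.
by rewrite (_ : (l == j :> nat) = false) ?mulr0 ?scale0r //; apply/negbTE.
Qed.

Lemma idd_phiE (i : nat) : (1 <= i <= n)%N ->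
  idd_phi (idd_e i) = (i%:R - 2) *: idd_e i.
Proof.
case: i => [//|i] /andP[_ ltin].
by rewrite lfunE (idd_eE (Ordinal ltin)) /= -rowE rowK -idd_eE.
Qed.

End IDD.

(* Main.v *)
Require Import Defs.
From HB Require Import structures.
From mathcomp Require Import all_boot all_order all_algebra.
From mathcomp Require Import boolp classical_sets reals complex.
From mathcomp Require Import ring zify.

Import GRing.Theory Num.Theory.
Local Open Scope ring_scope.
Local Open Scope classical_set_scope.

(** Reading [idd_e i] as the monomial x^i, the product is a <> b = a'' b with
    the monomials outside x, ..., x^n discarded.  It is graded by i - 2, and
    [idd_phi] is the operator multiplying by the degree, hence a derivation.

    Conversely let D be a derivation.  Right multiplication by e_1 is
    essentially the second derivative, so its kernel is the line of e_1
    ([idd_mul_e1_eq0]).  Applying D to e_1 <> e_1 = 0 and, since e_2 acts on the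
    left as twice the identity, to e_2 <> e_1 = 2 e_1, one finds that D e_1 and
    D e_2 lie in that kernel: D e_1 = l e_1 and D e_2 = c e_1.  The relation
    e_3 <> e_1 = 6 e_2 then determines D e_3 up to a multiple of e_1, with e_2
    coefficient 3c, whereas e_3 <> e_2 = 6 e_3 makes that coefficient 2c and the
    e_1 coefficient 0.  So c = 0 and D e_3 = - l e_3 ([der_e123]).  Since left
    multiplication by e_3 is six times the shift e_j |-> e_(j+1), the values at
    e_1 and e_3 propagate along the whole basis and give D = - l phi. *)

Section Derivations.
Variables (F : numFieldType) (n : nat).
Local Notation A := (IDD F n).
Local Notation mul := (@idd_mul F n).
Local Notation e := (@idd_e F n).

HB.instance Definition _ (x : A) :=
  GRing.isLinear.Build F A A *:%R (mul x) (@idd_mul_linearr F n x).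

(** Right multiplication is named so that it can carry a linear structure. *)
Definition idd_mulr (y x : A) : A := mul x y.

HB.instance Definition _ (y : A) :=
  GRing.isLinear.Build F A A *:%R (idd_mulr y) (@idd_mul_linearl F n y).

Lemma idd_mulDl (x y z : A) : mul (x + y) z = mul x z + mul y z.
Proof. exact: (linearD (idd_mulr z)). Qed.

Lemma idd_mulZl k (x z : A) : mul (k *: x) z = k *: mul x z.
Proof. exact: (linearZ_LR (idd_mulr z)). Qed.

Lemma idd_mulBl (x y z : A) : mul (x - y) z = mul x z - mul y z.
Proof. exact: (linearB (idd_mulr z)). Qed.

Lemma idd_mul_suml (f : 'I_n -> A) z :
  mul (\sum_i f i) z = \sum_i mul (f i) z.
Proof. exact: (linear_sum (idd_mulr z)). Qed.

Lemma idd_mulZr k (x z : A) : mul x (k *: z) = k *: mul x z.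
Proof. exact: (linearZ_LR (mul x)). Qed.

Lemma idd_mul_sumr (f : 'I_n -> A) x :
  mul x (\sum_i f i) = \sum_i mul x (f i).
Proof. exact: (linear_sum (mul x)). Qed.

Lemma idd_sum_e (x : A) : x = \sum_(i < n) (x : 'rV_n) 0 i *: e i.+1.
Proof.
rewrite {1}(row_sum_delta (x : 'rV[F]_n)).
by apply: eq_bigr => i _; rewrite idd_eE.
Qed.

Lemma idd_End_ext (f g : 'End(A)) :
  (forall k, (k < n)%N -> f (e k.+1) = g (e k.+1)) -> f = g.
Proof.
move=> fg; apply/lfunP => x; rewrite (idd_sum_e x) !linear_sum.
by apply: eq_bigr => i _; rewrite !linearZ /= fg.
Qed.

(** Both sides of the Leibniz rule are bilinear: first the left factor is freed
    with a basis vector on the right, then the right factor. *)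
Lemma Der_on_basis (D : 'End(A)) :
  (forall i j, (i < n)%N -> (j < n)%N ->
     D (mul (e i.+1) (e j.+1)) =
     mul (D (e i.+1)) (e j.+1) + mul (e i.+1) (D (e j.+1))) ->
  Der mul D.
Proof.
move=> De a b.
pose r y : 'End(A) := linfun (idd_mulr y); pose l x : 'End(A) := linfun (mul x).
have rE y x : r y x = mul x y by rewrite lfunE.
have lE x y : l x y = mul x y by rewrite lfunE.
have Dr j x : (j < n)%N ->
    D (mul x (e j.+1)) = mul (D x) (e j.+1) + mul x (D (e j.+1)).
  move=> jn.
  have : (D \o r (e j.+1) = r (e j.+1) \o D + r (D (e j.+1)))%VF.
    by apply: idd_End_ext => i ?; rewrite add_lfunE !comp_lfunE !rE De.
  by move/lfunP/(_ x); rewrite add_lfunE !comp_lfunE !rE.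
have : (D \o l a = l (D a) + (l a \o D))%VF.
  by apply: idd_End_ext => j ?; rewrite add_lfunE !comp_lfunE !lE Dr.
by move/lfunP/(_ b); rewrite add_lfunE !comp_lfunE !lE.
Qed.

(** The product respects the grading deg e_i = i - 2, whose degree operator is
    [idd_phi]. *)
Lemma idd_phi_Der : Der mul (@idd_phi F n).
Proof.
apply: Der_on_basis => i j lin ljn.
rewrite !idd_phiE // idd_mulZl linearZ /= -scalerDl idd_mulE //.
case: ifP => [/andP[h1 h2]|_]; last by rewrite linear0 scaler0.
rewrite linearZ /= idd_phiE; last lia.
rewrite !scalerA mulrC; congr (_ * _ *: _).
by rewrite natrB ?natrD; [ring | lia].
Qed.

(** x <> e_1 is x'' multiplied by the first power of the variable: its
    coefficient at e_(k+1) is (k + 2)(k + 1) times that of x at e_(k+2), and in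
    characteristic 0 its vanishing leaves only the e_1 coefficient of x. *)
Lemma idd_mul_e1_eq0 (n0 : (0 < n)%N) (x : A) :
  mul x (e 1) = 0 -> exists c, x = c *: e 1.
Proof.
move=> x0; exists ((x : 'rV_n) 0 (Ordinal n0)); apply/rowP => -[[|k] lk]; rewrite !mxE eqSS.
  by rewrite mulr1; congr (_ _ _); apply: val_inj.
rewrite mulr0; have lk' : (k < n)%N by lia.
have /rowP/(_ (Ordinal lk')) := x0.
rewrite {1}(idd_sum_e x) idd_mul_suml summxE (bigD1 (Ordinal lk)) //=.
rewrite big1 => [|i ik].
  rewrite idd_mulZl idd_mulE; [|lia..].
  rewrite ifT; last lia.
  rewrite !mxE (_ : k.+2 + 1 - 2 = k.+1)%N ?eqxx ?addr0; last lia.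
  by rewrite mulr1 => /eqP; rewrite mulf_eq0 pnatr_eq0 /= subn1 orbF => /eqP.
rewrite idd_mulZl idd_mulE; [|have := ltn_ord i; lia|lia].
case: ifP => _; last by rewrite scaler0 mxE.
rewrite !mxE (_ : (_ == _) = false) ?mulr0 //.
by move: ik; rewrite -val_eqE /=; lia.
Qed.

Lemma idd_mul_e1l (n0 : (0 < n)%N) (x : A) : mul (e 1) x = 0.
Proof.
rewrite (idd_sum_e x) idd_mul_sumr big1 // => i _.
by rewrite idd_mulZr idd_mulE ?ltn_ord // subnn muln0 scale0r if_same scaler0.
Qed.

Lemma idd_mul_e2l (n2 : (2 <= n)%N) (x : A) : mul (e 2) x = 2 *: x.
Proof.
rewrite {1}(idd_sum_e x) {2}(idd_sum_e x) idd_mul_sumr scaler_sumr.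
apply: eq_bigr => i _; rewrite idd_mulZr idd_mulE; [|lia|have := ltn_ord i; lia].
rewrite ifT; last by have := ltn_ord i; lia.
by rewrite !scalerA mulrC; congr (_ *: e _); lia.
Qed.

(** The products without truncation; the index and the coefficient of the result
    are parameters, so that they can be given in computed form. *)
Lemma idd_mulE_in (i j k m : nat) :
  (1 <= i <= n)%N -> (1 <= j <= n)%N -> (i + j = k + 2)%N -> (1 <= k <= n)%N ->
  (i * (i - 1) = m)%N -> mul (e i) (e j) = m%:R *: e k.
Proof.
move=> hi hj hk k1 <-; rewrite idd_mulE // ifT; last lia.
by congr (_ *: e _); lia.
Qed.

(** Two evaluations of D e_3, through e_3 <> e_1 and through e_3 <> e_2, force
    D e_2 = 0. *)
Lemma der_e123 (D : 'End(A)) : (3 <= n)%N -> Der mul D ->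
  exists l, D (e 1) = l *: e 1 /\ D (e 3) = - l *: e 3.
Proof.
move=> n3 dD; have n0 : (0 < n)%N by lia.
have e21 : mul (e 2) (e 1) = 2 *: e 1 by apply: idd_mul_e2l; lia.
have e22 : mul (e 2) (e 2) = 2 *: e 2 by apply: idd_mul_e2l; lia.
have e31 : mul (e 3) (e 1) = 6 *: e 2 by apply: idd_mulE_in; lia.
have e32 : mul (e 3) (e 2) = 6 *: e 3 by apply: idd_mulE_in; lia.
have [l Dl] : exists l, D (e 1) = l *: e 1.
  apply: (idd_mul_e1_eq0 n0).
  have := dD (e 1) (e 1); rewrite !idd_mul_e1l // linear0 addr0.
  exact: esym.
have [c Dc] : exists c, D (e 2) = c *: e 1.
  apply: (idd_mul_e1_eq0 n0).
  have := dD (e 2) (e 1); rewrite e21 linearZ /= idd_mul_e2l; last lia.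
  by move=> /eqP; rewrite -subr_eq subrr eq_sym => /eqP.
have [d Dd] : exists d, D (e 3) = d *: e 1 + (3 * c) *: e 2 - l *: e 3.
  have : mul (D (e 3) - ((3 * c) *: e 2 - l *: e 3)) (e 1) = 0.
    have := dD (e 3) (e 1); rewrite e31 linearZ /= Dc Dl idd_mulZr e31.
    move/eqP; rewrite -subr_eq => /eqP E.
    rewrite !idd_mulBl -E !idd_mulZl e21 e31 !scalerA.
    by apply/rowP => j; rewrite !mxE; ring.
  move/(idd_mul_e1_eq0 n0) => [d /eqP]; rewrite subr_eq addrA => /eqP Ed.
  by exists d.
have E := dD (e 3) (e 2).
rewrite e32 linearZ /= Dc idd_mulZr e31 Dd in E.
rewrite idd_mulBl idd_mulDl !idd_mulZl idd_mul_e1l // e22 e32 in E.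
have n1 : (1 < n)%N by lia.
(* E reads 6 d e_1 + 18 c e_2 - 6 l e_3 = 12 c e_2 - 6 l e_3. *)
have := congr1 (fun x : 'rV[F]_n => x 0 (Ordinal n0)) E.
have := congr1 (fun x : 'rV[F]_n => x 0 (Ordinal n1)) E.
rewrite !mxE /= => Ec Ed.
have c0 : c = 0.
  have : 6 * c = 0 by move: Ec; move=> /eqP; rewrite -subr_eq0 => /eqP <-; ring.
  by move/eqP; rewrite mulf_eq0 pnatr_eq0 /= => /eqP.
have d0 : d = 0.
  have : 6 * d = 0 by move: Ed; move=> /eqP; rewrite -subr_eq0 => /eqP <-; ring.
  by move/eqP; rewrite mulf_eq0 pnatr_eq0 /= => /eqP.
exists l; split=> //.
by rewrite Dd c0 d0 mulr0 !scale0r !add0r scaleNr.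
Qed.

(** Left multiplication by e_3 is six times the shift of the basis, so D e_1
    and D e_3 determine D. *)
Lemma Der_phi_multiple (D : 'End(A)) : (3 <= n)%N -> Der mul D ->
  exists k, D = k *: @idd_phi F n.
Proof.
move=> n3 dD; have [l [D1 D3]] := der_e123 D n3 dD.
exists (- l); apply: idd_End_ext; elim=> [|k IH] kn.
  by rewrite D1 scale_lfunE idd_phiE // scalerA; congr (_ *: _); ring.
have e3k : mul (e 3) (e k.+1) = 6 *: e k.+2 by apply: idd_mulE_in; lia.
have := dD (e 3) (e k.+1).
rewrite IH; last lia.
rewrite e3k D3 linearZ /= !scale_lfunE !idd_phiE; [|lia..].
rewrite !scalerA linearZ /= idd_mulZl e3k !scalerA -scalerDl => E.
have n6 : 6 != 0 :> F by rewrite pnatr_eq0.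
apply: (scalerI n6); rewrite E scalerA; congr (_ *: _).
by rewrite -!natr1; ring.
Qed.

Lemma Der_scale_phi k : Der mul (k *: @idd_phi F n).
Proof.
move=> a b; rewrite !scale_lfunE idd_phi_Der scalerDr idd_mulZl.
by rewrite linearZ.
Qed.

End Derivations.

Theorem theorem4p5 (R : realType) (n : nat) (hn : (3 <= n)%N) :
  Der (@idd_mul R[i] n) = [set D | D \in <[idd_phi R[i] n]>%VS].
Proof.
apply/seteqP; split=> D /=.
  by move=> /(Der_phi_multiple _ _ _ hn) h; apply/vlineP.
by move=> /vlineP [k ->]; apply: Der_scale_phi.
Qed.
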